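(* Let $\Gamma$ be a metric graph, let $r\ge 0$ be an integer, let $D$ be a divisor on $\Gamma$ and let $\mathfrak S$ be a slope structure of width $r$ on $\Gamma$. Let $M\subseteq \mathrm{Rat}(D,\mathfrak S)$ be an admissible semimodule of rank $r$ with underlying slope structure $\mathfrak S$. Let $v$ be a point of $\Gamma$ and let $\underline a$ be a jump of the rank function $\rho_v$. Then there exists $f\in M$ such that $\partial_v(f)=s_{\underline a}$.
   Context: Metric graphs. A metric graph $\Gamma$ is the metric realization of a pair $(G,\ell)$, where $G=(V,E)$ is a finite connected graph with at least one edge and $\ell\colon E\to\mathbb R_{>0}$: each edge $e$ is replaced by a closed interval of length $\ell(e)$, glued according to $G$, with the path metric. $G$ (with $\ell$) is called a model of $\Gamma$; a model is simple if it has no loops and no parallel edges. $\mathrm T_x(\Gamma)$ is the finite set of outgoing unit tangent vectors at $x$, and $d_x=|\mathrm T_x(\Gamma)|$. $\mathrm{Rat}(\Gamma)$ is the set of continuous piecewise affine functions $f\colon\Gamma\to\mathbb R$ with integral slopes; $\mathrm{slope}_\nu(f)$ is the outgoing slope of $f$ along $\nu$. A divisor $D$ is a finite formal integer combination of points of $\Gamma$, $D(x)$ is its coefficient at $x$, $D\ge 0$ (effective) means all coefficients are $\geq 0$. $\mathrm{div}(f)=\sum_x \mathrm{ord}_x(f)(x)$ with $\mathrm{ord}_x(f)=-\sum_{\nu\in \mathrm T_x(\Gamma)}\mathrm{slope}_\nu(f)$. $\mathrm{Rat}(D)=\{f\in\mathrm{Rat}(\Gamma): D+\mathrm{div}(f)\ge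 0\}$. Hypercube rank functions. Put $[r]=\{0,\dots,r\}$. The hypercube $[r]^\delta$ ($\delta\geq 1$) carries the coordinatewise order $\preceq$ and coordinatewise max $\vee$ and min $\wedge$; $\underline e_i$ is the $i$-th unit vector. A rank function is a map $\rho\colon[r]^\delta\to\mathbb Z$ such that: (1) $\rho(t\,\underline e_i)=r-t$ for all $i$ and $t\in[r]$; (2) $\underline a\preceq\underline b$ implies $\rho(\underline b)\le\rho(\underline a)$; (3) $\rho(\underline a)+\rho(\underline b)\le\rho(\underline a\vee\underline b)+\rho(\underline a\wedge\underline b)$; (4) $\rho$ takes values in $\{-1,0,\dots,r\}$. A jump of $\rho$ is a point $\underline a$ with $\rho(\underline a)\ge 0$ and $\rho(\underline a+\underline e_i)=\rho(\underline a)-1$ for every $i$ with $\underline a+\underline e_i\in[r]^\delta$. The standard rank function is $\rho(\underline a)=\max\{-1,r-a_1-\dots-a_\delta\}$. Slope structures. A slope structure $\mathfrak S$ of width $r$ on $\Gamma$ is the data, on some simple graph model $G=(V,E)$ of $\Gamma$, of: for every oriented edge $uv$, a set $S^{uv}$ of integers $s_0^{uv}<\dots<s_r^{uv}$ with $s_i^{uv}+s_{r-i}^{vu}=0$; for every $v\in V$, a rank function $\rho_v$ on $[r]^{d_v}$, whose coordinates are indexed by the oriented edges with tail $v$ (equivalently by $\mathrm T_v(\Gamma)$). It is extended to all of $\Gamma$: for $\nu\in \mathrm T_x(\Gamma)$, $S^\nu=\{s_0^\nu<\dots<s_r^\nu\}$ is $S^{uv}$ for the oriented edge $uv$ parallel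 to $\nu$; for $x\in\Gamma\setminus V$, $\rho_x$ is the standard rank function on $[r]^2$. For $\underline a=(a_\nu)_\nu\in[r]^{\mathrm T_x(\Gamma)}$ put $s_{\underline a}=(s^\nu_{a_\nu})_\nu$, and let $S^x=\{s_{\underline a}:\underline a\text{ a jump of }\rho_x\}$. A function $f\in\mathrm{Rat}(\Gamma)$ is compatible with $\mathfrak S$ if for every $x\in\Gamma$, $\mathrm{slope}_\nu(f)\in S^\nu$ for all $\nu\in\mathrm T_x(\Gamma)$, and $\partial_x(f):=(\mathrm{slope}_\nu(f))_{\nu\in \mathrm T_x(\Gamma)}\in S^x$. If $\partial_x(f)=s_{\underline a}$, write $\rho_x(\partial_x(f)):=\rho_x(\underline a)$. $\mathrm{Rat}(D,\mathfrak S)$ is the set of $f\in\mathrm{Rat}(D)$ compatible with $\mathfrak S$. Admissible semimodules. A semimodule is a subset of $\mathrm{Rat}(\Gamma)$ stable under $(f,g)\mapsto\min(f,g)$ and $f\mapsto f+c$, $c\in\mathbb R$. A semimodule $M\subseteq\mathrm{Rat}(D)$ is admissible of rank $r$, with underlying slope structure $\mathfrak S$, if it is closed for the topology of $\|\cdot\|_\infty$, $\mathfrak S$ is a slope structure of width $r$ with $M\subseteq\mathrm{Rat}(D,\mathfrak S)$, and for every effective divisor $E$ of degree $r$ there is $f\in M$ with $\rho_x(\partial_x(f))\ge E(x)$ for all $x\in\Gamma$ and $D+\mathrm{div}(f)-E\ge 0$. *)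

(* Defs.v *)
From HB Require Import structures.
From mathcomp Require Import all_boot all_order all_algebra.
From mathcomp Require Import finmap.
From mathcomp Require Import all_classical all_reals all_analysis.

Set Implicit Arguments.
Unset Strict Implicit.
Unset Printing Implicit Defensive.

Import Order.TTheory GRing.Theory Num.Theory.
Import numFieldNormedType.Exports.

Local Open Scope classical_set_scope.
Local Open Scope ring_scope.

(* A metric graph is given by one of its models (G, l). Multigraphs with loops
   are allowed; every edge e carries an auxiliary reference orientation, from
   [endpoint e false] to [endpoint e true]. *)
Record metric_graph (R : realType) := MetricGraph {
  vertices : finType;
  edges : finType;
  endpoint : edges -> bool -> vertices;
  len : edges -> R;
  len_gt0 : forall e, 0 < len e;
  exists_edge : (0 < #|edges|)%N;
  graph_connected : forall u v : vertices,
    connect (fun x y => [exists e, exists b,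
      (endpoint e b == x) && (endpoint e (~~ b) == y)]) u v
}.

Definition simple_graph (R : realType) (G : metric_graph R) : Prop :=
  (forall e : edges G, endpoint e false <> endpoint e true) /\
  (forall e e' : edges G,
     [set endpoint e false; endpoint e true]%SET =
     [set endpoint e' false; endpoint e' true]%SET -> e = e').

Section Points.
Variables (R : realType) (G : metric_graph R).

(* [(e, b)] is the edge e oriented from [endpoint e b] to [endpoint e (~~ b)] *)
Definition oedge : finType := (edges G * bool)%type.
Definition tail (a : oedge) : vertices G := endpoint a.1 a.2.
Definition rev_oedge (a : oedge) : oedge := (a.1, ~~ a.2).

(* The points of the realization: [inl v] is a vertex; [inr (e, t)] is the point
   of the open edge e at distance t from [endpoint e false]. *)
Definition raw_point : choiceType := (vertices G + edges G * R)%type.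

Definition is_point (p : raw_point) : bool :=
  match p with
  | inl _ => true
  | inr (e, t) => 0 < t < len e
  end.

Definition gpoint : choiceType := {p : raw_point | is_point p}.

Definition vertex (v : vertices G) : gpoint :=
  exist (fun p => is_point p) (inl v) isT.

(* The gluing map of the closed edge [0, len e]; parameters t <= 0 and
   t >= len e are sent to the corresponding endpoint. *)
Definition edge_point (e : edges G) (t : R) : gpoint :=
  insubd (vertex (endpoint e (0 < t))) (inr (e, t) : raw_point).

(* the point of the edge of a at distance t from the tail of a *)
Definition oedge_point (a : oedge) (t : R) : gpoint :=
  edge_point a.1 (if a.2 then len a.1 - t else t).

(* An outgoing unit tangent vector at a point is encoded by the oriented edge
   parallel to it. A loop at v contributes its two orientations. *)
Definition tangents (p : raw_point) : {set oedge} :=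
  match p with
  | inl v => [set a | tail a == v]%SET
  | inr (e, _) => [set a | a.1 == e]%SET
  end.

Definition raw_tangent (p : raw_point) : finType := {a : oedge | a \in tangents p}.

Definition tangent (x : gpoint) : finType := raw_tangent (val x).

(* distance, along the edge of a, from the tail of a to the point *)
Definition offset (p : raw_point) (a : oedge) : R :=
  match p with
  | inl _ => 0
  | inr (e, t) => if a.2 then len e - t else t
  end.

Definition travel (x : gpoint) (nu : tangent x) (s : R) : gpoint :=
  oedge_point (val nu) (offset (val x) (val nu) + s).

(* Rat(Gamma). The affine pieces are closed intervals and consecutive ones share
   their breakpoint, so continuity is built in. *)
Definition RatG : set (gpoint -> R) :=
  [set f | forall e : edges G, exists (n : nat) (tau : nat -> R),
    [/\ tau 0%N = 0, tau n = len e,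
        forall i, (i < n)%N -> tau i < tau i.+1 &
        forall i, (i < n)%N -> exists m : int,
          forall t, tau i <= t <= tau i.+1 ->
            f (edge_point e t) =
            f (edge_point e (tau i)) + m%:~R * (t - tau i)]].

(* The outgoing slope: the unique m with f (x + s nu) = f x + m s for all small
   s > 0 (it exists when f is in Rat(Gamma)). *)
Definition slope (f : gpoint -> R) (x : gpoint) (nu : tangent x) : int :=
  xget 0 [set m : int |
    \forall s \near (0 : R)^'+, f (travel nu s) = f x + m%:~R * s].

Definition partial (f : gpoint -> R) (x : gpoint) : {ffun tangent x -> int} :=
  [ffun nu => slope f nu].

Definition divisor := {fsfun gpoint -> int with 0}.

Definition effective (D : divisor) : Prop := forall x, 0 <= D x.

Definition degree (D : divisor) : int := \sum_(x <- finsupp D) D x.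

(* the coefficient of div(f) at x *)
Definition ord_at (f : gpoint -> R) (x : gpoint) : int :=
  - \sum_(nu : tangent x) slope f nu.

Definition RatD (D : divisor) : set (gpoint -> R) :=
  [set f | RatG f /\ forall x, 0 <= D x + ord_at f x].

End Points.

Arguments slope {R G} f {x} nu.

Section Hypercube.
Variables (I : finType) (r : nat).

(* the hypercube [r]^I, with [r] = {0, ..., r} *)
Definition cube : finType := {ffun I -> 'I_r.+1}.

Definition cube_le (a b : cube) : Prop := forall i, (a i <= b i)%N.
Definition cube_join (a b : cube) : cube := [ffun i => Order.max (a i) (b i)].
Definition cube_meet (a b : cube) : cube := [ffun i => Order.min (a i) (b i)].

(* t e_i *)
Definition cube_axis (i : I) (t : 'I_r.+1) : cube :=
  [ffun j => if j == i then t else ord0].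

Definition rank_function (rho : cube -> int) : Prop :=
  [/\ forall i (t : 'I_r.+1), rho (cube_axis i t) = r%:Z - t%:Z,
      forall a b, cube_le a b -> rho b <= rho a,
      forall a b, rho a + rho b <= rho (cube_join a b) + rho (cube_meet a b) &
      forall a, -1 <= rho a <= r%:Z].

(* b ranges over the points a + e_i that lie in the hypercube *)
Definition jump (rho : cube -> int) (a : cube) : Prop :=
  0 <= rho a /\
  forall (i : I) (b : cube),
    (forall j, b j = a j + (j == i) :> nat)%N -> rho b = rho a - 1.

Definition standard_rank (a : cube) : int :=
  Num.max (-1) (r%:Z - \sum_i (a i)%:Z).

End Hypercube.

(* [slopes a i] is s_i^a. The model underlying the structure is the one by which
   the metric graph is given; it is required to be simple. *)
Record slope_structure (R : realType) (G : metric_graph R) (r : nat) :=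
  SlopeStructure {
  slope_model_simple : simple_graph G;
  slopes : oedge G -> 'I_r.+1 -> int;
  slopes_incr : forall a (i j : 'I_r.+1), (i < j)%N -> slopes a i < slopes a j;
  slopes_rev : forall a i, slopes a i + slopes (rev_oedge a) (rev_ord i) = 0;
  vertex_rank : forall v : vertices G, cube (tangent (vertex v)) r -> int;
  vertex_rankP : forall v, rank_function (vertex_rank (v := v))
}.

Section Admissible.
Variables (R : realType) (G : metric_graph R) (r : nat).
Variable S : slope_structure G r.

(* rho_x at an arbitrary point x: the given one at vertices, standard elsewhere *)
Definition raw_rank (p : raw_point G) : cube (raw_tangent p) r -> int :=
  match p return cube (raw_tangent p) r -> int with
  | inl v => vertex_rank S (v := v)
  | inr _ => @standard_rank _ r
  end.

Definition rank_at (x : gpoint G) : cube (tangent x) r -> int :=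
  @raw_rank (val x).

(* s_a *)
Definition slope_vector (x : gpoint G) (a : cube (tangent x) r) :
    {ffun tangent x -> int} :=
  [ffun nu => slopes S (val nu) (a nu)].

(* S^x *)
Definition slope_vectors (x : gpoint G) : set {ffun tangent x -> int} :=
  [set slope_vector a | a in [set a | jump (@rank_at x) a]].

Definition compatible (f : gpoint G -> R) : Prop :=
  forall x : gpoint G,
    (forall nu : tangent x, exists i, slope f nu = slopes S (val nu) i) /\
    slope_vectors (partial f x).

(* rho_x(partial_x f), i.e. rho_x(a) for the unique a with partial_x f = s_a *)
Definition rank_partial (f : gpoint G -> R) (x : gpoint G) : int :=
  rank_at (xget [ffun=> ord0]
    [set a : cube (tangent x) r | partial f x = slope_vector a]).

Definition RatDS (D : divisor G) : set (gpoint G -> R) :=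
  [set f | RatD D f /\ compatible f].

Definition semimodule (M : set (gpoint G -> R)) : Prop :=
  [/\ M `<=` @RatG R G,
      forall f g, M f -> M g -> M (fun x => Num.min (f x) (g x)) &
      forall f (c : R), M f -> M (fun x => f x + c)].

(* closed in Rat(Gamma) for the topology of uniform convergence *)
Definition uniformly_closed (M : set (gpoint G -> R)) : Prop :=
  closure (M : set {uniform gpoint G -> R}) `&` @RatG R G `<=` M.

Definition admissible (D : divisor G) (M : set (gpoint G -> R)) : Prop :=
  [/\ semimodule M,
      uniformly_closed M,
      M `<=` RatDS D &
      forall E : divisor G, effective E -> degree E = r%:Z ->
        exists f, [/\ M f,
          forall x, E x <= rank_partial f x &
          forall x, 0 <= D x + ord_at f x - E x]].

End Admissible.

Arguments rank_at {R G r} S x.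
Arguments slope_vector {R G r} S {x} a.

(* Main.v *)
Require Import Defs.
From mathcomp Require Import all_boot all_order all_algebra.
From mathcomp Require Import finmap zify ring lra.
From mathcomp Require Import all_classical all_reals all_analysis.

(** Put a divisor of degree [r - k] near [v] and [k] times the point [v], where
    [k] is the rank of the jump [a]; admissibility gives a function [f] of [M]
    meeting all these rank conditions, and the task is to place the points so
    that no other jump than [a] can be the slope vector of [f] at [v]. On an
    edge, the index of the outgoing slope cannot increase as one moves along,
    and at an interior point the rank is the number of indices that are skipped
    there. Hence a point [y] on the branch [nu], with [rank >= 1] required
    there, makes the slope index of [f] at [v] along [nu] larger than the one
    past [y].

    With all points at comparable distances this is not enough: the sum of the
    coordinates of [a] may exceed [r - k], and a bound from below by a vector of
    weight [r - k] need not single out [a]. So the points are put at distances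
    of different orders of magnitude, one at a time, each much closer to [v]
    than the previous ones, along a chain of jumps [0 = a_0 < a_1 < .. < a] on
    which the rank drops by exactly one.

    The chain exists by supermodularity. Every vector [c] of nonnegative rank
    lies below a least jump, which has the rank of [c] ([jump_closure]). If [a']
    is maximal among the jumps strictly below [a] and [a' nu < a nu], the least
    jump above [a' + e_nu] is [a]; so [rank a' = rank a + 1], and a jump above
    [a'] with a larger coordinate at [nu] is above [a] ([jump_pred]).

    Suppose that points [s] have been found which force the vector [a'] on the
    functions of rank at least [rank a'] at [v] ([forces]). Then, for some small
    enough distance, adding a point [y] on the branch [nu] forces [a]
    ([forces_step]). Otherwise there are counterexamples [f_n] with [y]
    converging to [v]; a limit [g] of them is in [M], as [M] is closed, and
    still meets the conditions at [s]. The slope vector [h] of [g] at [v] is a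
    jump below the vector [l] of a suitable [f_n], strictly so at [nu] because
    the index skipped at [y] is skipped at [v] in the limit. A strictly smaller
    jump has a strictly larger rank, so [rank h >= rank a + 1 = rank a'], and
    [h = a'] by the choice of [s]. Therefore [l] is above [a'] with a larger
    coordinate at [nu], so above [a]; since its rank is at least that of [a],
    [l = a], a contradiction.

    Existence of the limit is compactness ([semimodule_limit]): a compatible
    function is determined, up to a constant, by the position [T e i] at which
    its slope on the edge [e] falls to its [i]-th value or below
    ([profiled_exists]), and these finitely many parameters range over compact
    intervals. *)

Set Implicit Arguments.
Unset Strict Implicit.
Unset Printing Implicit Defensive.

Import Order.TTheory GRing.Theory Num.Theory.
Import numFieldNormedType.Exports.

Local Open Scope classical_set_scope.
Local Open Scope ring_scope.

(** * Jumps of hypercube rank functions *)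

Section CubeOrder.
Variables (I : finType) (r : nat).
Implicit Types a b c d : cube I r.

Lemma cube_eqP a b : (forall i, a i = b i :> nat) -> a = b.
Proof. by move=> ab; apply/ffunP => i; apply: val_inj; exact: ab. Qed.

Lemma cube_le_anti a b : cube_le a b -> cube_le b a -> a = b.
Proof.
by move=> ab ba; apply: cube_eqP => i; apply/eqP; rewrite eqn_leq ab ba.
Qed.

Lemma cube_le_lt a b : cube_le a b -> a <> b -> exists i, (a i < b i)%N.
Proof.
move=> ab neq; apply: contrapT => /forallNP lt; apply: neq.
apply: cube_le_anti => // i; rewrite leqNgt; exact/negP/lt.
Qed.

Lemma cube_joinE a b i : cube_join a b i = maxn (a i) (b i) :> nat.
Proof.
rewrite ffunE /Order.max ltEord /maxn.
by case: ifP.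
Qed.

Lemma cube_meetE a b i : cube_meet a b i = minn (a i) (b i) :> nat.
Proof.
by rewrite ffunE /Order.min ltEord /minn; case: ifP.
Qed.

Definition cube_weight a : nat := (\sum_i a i)%N.

Lemma cube_weight_lt a b : cube_le a b -> a <> b ->
  (cube_weight a < cube_weight b)%N.
Proof.
move=> ab /(cube_le_lt ab)[i lti].
rewrite /cube_weight (bigD1 i) //= [ltnRHS](bigD1 i) //= -addSn leq_add //.
by apply: leq_sum => j _; exact: ab.
Qed.

(** The value is meaningful for [a i < r] only. *)
Definition cube_incr a i : cube I r :=
  [ffun j => if j == i then inord (a j).+1 else a j].

Lemma cube_incrE a i j : (a i < r)%N ->
  cube_incr a i j = (a j + (j == i))%N :> nat.
Proof.
move=> ltr; rewrite ffunE; case: eqP => [->|_]; last by rewrite addn0.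
by rewrite inordK ?addn1.
Qed.

Lemma cube_incr_le a b i : cube_le a b -> (a i < b i)%N ->
  cube_le (cube_incr a i) b.
Proof.
move=> ab lti j; rewrite cube_incrE; last first.
  by apply: leq_trans lti _; rewrite -ltnS.
by case: eqP => [->|_]; rewrite ?addn1 ?addn0.
Qed.

End CubeOrder.

Section RankFunction.
Variables (I : finType) (r : nat) (rho : cube I r -> int).
Hypothesis rhoP : rank_function rho.
Implicit Types a b c d : cube I r.

Let rho_axis i t : rho (cube_axis i t) = r%:Z - t%:Z.
Proof. by case: rhoP. Qed.

Let rho_mono a b : cube_le a b -> rho b <= rho a.
Proof. by case: rhoP => _ + _ _; exact. Qed.

Let rho_super a b :
  rho a + rho b <= rho (cube_join a b) + rho (cube_meet a b).
Proof. by case: rhoP. Qed.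

(** Supermodularity for [a] and the axis vector through [b], whose meet with [a]
    is the axis vector through [a]. *)
Lemma rank_succ_ge i a b :
  (forall j, b j = a j + (j == i) :> nat)%N -> rho a - 1 <= rho b.
Proof.
move=> bE; have := rho_super a (cube_axis i (b i)).
rewrite rho_axis.
have -> : cube_join a (cube_axis i (b i)) = b.
  apply: cube_eqP => j; rewrite cube_joinE ffunE bE.
  by case: eqP => [->|_] /=; rewrite ?bE ?eqxx /= ?addn0 ?addn1; lia.
have -> : cube_meet a (cube_axis i (b i)) = cube_axis i (a i).
  apply: cube_eqP => j; rewrite cube_meetE !ffunE.
  by case: eqP => [->|_] /=; rewrite ?bE ?eqxx /= ?addn1 ?minn0; lia.
by rewrite rho_axis (bE i) eqxx; lia.
Qed.

(** Leaving a jump upwards in any direction costs one unit of rank. *)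
Lemma jump_maximal a b : jump rho a -> cube_le a b -> rho a <= rho b -> a = b.
Proof.
move=> [_ ja] ab rab; apply: contrapT => /(cube_le_lt ab)[i lti].
have := rho_mono (cube_incr_le ab lti).
rewrite (ja i (cube_incr a i)); first by move: rab; lia.
by move=> j; rewrite cube_incrE //; apply: leq_trans lti _; rewrite -ltnS.
Qed.

(** A vector of maximal weight among those above [c] with the same rank is a
    jump. It is the least one: for a jump [d] above [c], supermodularity shows
    that the join with [d] has at least the rank of [d], so it is [d]. *)
Lemma jump_closure c : 0 <= rho c -> exists b,
  [/\ jump rho b, cube_le c b, rho b = rho c &
      forall d, jump rho d -> cube_le c d -> cube_le b d].
Proof.
move=> c0; pose P b := [forall j, (c j <= b j)%N] && (rho b == rho c).
have Pc : P c by rewrite /P eqxx andbT; apply/forallP.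
case: (@arg_maxnP _ c P (@cube_weight I r) Pc) => b /andP[/forallP cb /eqP rb] bmax.
exists b; split => //.
- split; first by rewrite rb.
  move=> i d dE; have := rank_succ_ge dE.
  have bd : cube_le b d by move=> j; rewrite dE leq_addr.
  have := rho_mono bd; case: (eqVneq (rho d) (rho b)) => [rdb|]; last by lia.
  have /bmax : P d.
    rewrite /P rdb rb eqxx andbT; apply/forallP => j.
    by apply: leq_trans (cb j) (bd j).
  rewrite /= leqNgt cube_weight_lt // => bdE.
  by have := dE i; rewrite -bdE eqxx; lia.
- move=> d jd cd; have := rho_super b d.
  have le1 : rho (cube_meet b d) <= rho c.
    by apply: rho_mono => j; rewrite cube_meetE leq_min cb cd.
  move=> le2; have E : d = cube_join b d.
    apply: jump_maximal => //; last by move: le1 le2; rewrite rb; lia.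
    by move=> j; rewrite cube_joinE leq_maxr.
  by move=> j; rewrite E cube_joinE leq_maxl.
Qed.

Lemma rank0 (i : I) : rho [ffun=> ord0] = r%:Z.
Proof.
have -> : [ffun=> ord0] = cube_axis i (ord0 : 'I_r.+1).
  by apply/ffunP => j; rewrite !ffunE; case: ifP.
by rewrite rho_axis subr0.
Qed.

Lemma jump0 (i : I) : jump rho [ffun=> ord0].
Proof.
rewrite /jump (rank0 i); split => // j b bE.
have -> : b = cube_axis j (b j).
  apply: cube_eqP => k; rewrite ffunE; case: eqP => [->//|/eqP kj].
  by rewrite bE ffunE (negPf kj).
by rewrite rho_axis bE ffunE eqxx.
Qed.

(** [a'] is a maximal jump strictly below [a]; the least jump above [a' + e_nu]
    lies between [a'] and [a], so it is [a]. *)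
Lemma jump_pred (i : I) a : jump rho a -> a <> [ffun=> ord0] ->
  exists a' nu, [/\ jump rho a', rho a' = rho a + 1 &
    forall d, jump rho d -> cube_le a' d -> (a' nu < d nu)%N -> cube_le a d].
Proof.
move=> ja a0; pose P b := `[< [/\ jump rho b, cube_le b a & b <> a] >].
have P0 : P [ffun=> ord0].
  by apply/asboolP; split; [exact: (jump0 i) | move=> j; rewrite ffunE | exact/nesym].
case: (@arg_maxnP _ _ P (@cube_weight I r) P0) => a' /asboolP[ja' a'a neq] a'max.
have [nu ltnu] := cube_le_lt a'a neq.
have ltr : (a' nu < r)%N by apply: leq_trans ltnu _; rewrite -ltnS.
have incrE := cube_incrE _ ltr.
have ca := cube_incr_le a'a ltnu.
have rc : rho (cube_incr a' nu) = rho a' - 1 by apply: ja'.2.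
have c0 : 0 <= rho (cube_incr a' nu).
  by apply: le_trans (rho_mono ca); case: ja.
have [b [jb cb rb bmin]] := jump_closure c0.
have ba : b = a.
  apply: contrapT => ba; have /a'max : P b by apply/asboolP; split => //; exact: bmin.
  rewrite /= leqNgt cube_weight_lt //.
    by move=> j; apply: leq_trans (cb j); rewrite incrE leq_addr.
  by move=> a'b; have := cb nu; rewrite incrE a'b eqxx; lia.
exists a', nu; split => //; first by rewrite -ba rb rc; lia.
by move=> d jd a'd ltd; rewrite -ba; apply: bmin => //; exact: cube_incr_le.
Qed.

End RankFunction.

(** The standard rank is a convex function of the weight, which is modular. *)
Lemma standard_rankP (I : finType) (r : nat) : rank_function (@standard_rank I r).
Proof.
have sumM (a b : cube I r) : cube_le a b ->
    \sum_i (a i)%:Z <= \sum_i (b i)%:Z.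
  by move=> ab; apply: ler_sum => j _; have := ab j; lia.
rewrite /standard_rank; split.
- move=> i t; rewrite (bigD1 i) //= big1 ?addr0 ?ffunE ?eqxx; last first.
    by move=> j /negPf ji; rewrite ffunE ji.
  by have := ltn_ord t; lia.
- by move=> a b /sumM; lia.
- move=> a b.
  have le1 : \sum_i (cube_meet a b i)%:Z <= \sum_i (a i)%:Z.
    by apply: sumM => j; rewrite cube_meetE geq_minl.
  have le2 : \sum_i (cube_meet a b i)%:Z <= \sum_i (b i)%:Z.
    by apply: sumM => j; rewrite cube_meetE geq_minr.
  have : \sum_i (a i)%:Z + \sum_i (b i)%:Z =
      \sum_i (cube_join a b i)%:Z + \sum_i (cube_meet a b i)%:Z.
    rewrite -!big_split; apply: eq_bigr => j _ /=.
    by rewrite cube_joinE cube_meetE -!PoszD [in RHS]addnC addn_min_max.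
  by move: le1 le2; lia.
- move=> a; have : 0 <= \sum_i (a i)%:Z by apply: sumr_ge0.
  by lia.
Qed.

(** * Points and tangent directions *)

Section EdgePoints.
Variables (R : realType) (G : metric_graph R).

Lemma edge_point_interior (e : edges G) t :
  0 < t < len e -> val (edge_point e t) = inr (e, t).
Proof. by move=> te; rewrite /edge_point insubdK. Qed.

Lemma edge_point0 (e : edges G) : edge_point e 0 = vertex (endpoint e false).
Proof. by rewrite /edge_point /insubd insubN //= ltxx. Qed.

Lemma edge_point_len (e : edges G) :
  edge_point e (len e) = vertex (endpoint e true).
Proof. by rewrite /edge_point /insubd insubN /= ?len_gt0 ?ltxx ?andbF. Qed.

Lemma gpoint_interior (e : edges G) t (h : is_point (inr (e, t) : raw_point G)) :
  exist (fun p => is_point p) (inr (e, t)) h = edge_point e t.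
Proof. by apply: val_inj; rewrite edge_point_interior. Qed.

Lemma gpoint_vertex (u : vertices G) (h : is_point (inl u : raw_point G)) :
  exist (fun p => is_point p) (inl u) h = vertex u.
Proof. exact: val_inj. Qed.

Lemma vertex_endpoint (a : oedge G) :
  vertex (tail a) = edge_point a.1 (if a.2 then len a.1 else 0).
Proof.
by case: a => e [] /=; rewrite /tail /= ?edge_point_len ?edge_point0.
Qed.

(** The coordinate of a point on the edge carrying a tangent direction; at a
    vertex it depends on which end of that edge the direction leaves. *)
Definition edge_coord (p : raw_point G) (a : oedge G) : R :=
  match p with
  | inl _ => if a.2 then len a.1 else 0
  | inr (_, t) => t
  end.

Lemma edge_point_coord (x : gpoint G) (nu : tangent x) :
  edge_point (val nu).1 (edge_coord (val x) (val nu)) = x.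
Proof.
case: x nu => -[u|[e t]] h [a /= ha]; rewrite inE in ha.
  by rewrite gpoint_vertex -(eqP ha) vertex_endpoint.
by rewrite gpoint_interior (eqP ha).
Qed.

Lemma coord_range (x : gpoint G) (nu : tangent x) :
  if (val nu).2 then 0 < edge_coord (val x) (val nu) <= len (val nu).1
  else 0 <= edge_coord (val x) (val nu) < len (val nu).1.
Proof.
case: x nu => -[u|[e t]] h [[e' b] /= ha]; rewrite inE in ha.
  by case: b ha => _; rewrite /= len_gt0 lexx.
by move/eqP: ha => /= ->; move: h => /= /andP[? ?]; case: b; lra.
Qed.

Lemma travelE (x : gpoint G) (nu : tangent x) (s : R) :
  travel nu s = edge_point (val nu).1
    (if (val nu).2 then edge_coord (val x) (val nu) - s
     else edge_coord (val x) (val nu) + s).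
Proof.
rewrite /travel /oedge_point; congr edge_point.
case: x nu => -[u|[e t]] h [[e' b] /= ha]; rewrite inE in ha.
  by case: b ha => _ /=; ring.
by move/eqP: ha => /= ->; case: b => /=; ring.
Qed.

Lemma slopeP (f : gpoint G -> R) (x : gpoint G) (nu : tangent x) (m : int) :
  (\forall s \near (0 : R)^'+, f (travel nu s) = f x + m%:~R * s) ->
  slope f nu = m.
Proof.
move=> hm; apply: xget_unique => // m' hm'.
have [s []] : exists s : R, 0 < s /\ m'%:~R * s = m%:~R * s.
  near (0 : R)^'+ => s; exists s; split; first by near: s; exact: nbhs_right_gt.
  apply: (addrI (f x)); transitivity (f (travel nu s)).
    by apply/esym; near: s; exact: hm'.
  by near: s; exact: hm.
move=> s0; have s1 : s != 0 by rewrite gt_eqF.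
by move/(mulIf s1)/intr_inj.
Unshelve. all: by end_near. Qed.

End EdgePoints.

(** * Slope profiles on an edge *)

Section Profile.
Variables (R : realType) (G : metric_graph R) (r : nat).
Variable S : slope_structure G r.
Implicit Types (T : edges G -> 'I_r -> R) (e : edges G) (i j : 'I_r).

Definition low i : 'I_r.+1 := widen_ord (leqnSn r) i.

Definition gap e i : int :=
  slopes S (e, false) (lift ord0 i) - slopes S (e, false) (low i).

(** The function on the edge [e] that vanishes at its starting point, has slope
    [s_0] past all the [T e i], and gains [s_(i+1) - s_i] before [T e i]. *)
Definition profile T e (t : R) : R :=
  (slopes S (e, false) ord0)%:~R * t +
  \sum_i (gap e i)%:~R * Num.min t (T e i).

Definition nested T : Prop :=
  (forall e i j, (i <= j)%N -> T e j <= T e i) /\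
  (forall e i, 0 <= T e i <= len e).

Definition profiled (f : gpoint G -> R) T : Prop :=
  nested T /\
  forall e t, 0 <= t <= len e ->
    f (edge_point e t) = f (edge_point e 0) + profile T e t.

Lemma slopes_mono a : {mono slopes S a : k l / (k < l)%N >-> k < l}.
Proof.
move=> k l; apply/idP/idP; last exact: slopes_incr.
case: (ltngtP k l) => // [lk|kl].
  by move=> /(lt_trans (slopes_incr S a lk)); rewrite ltxx.
by rewrite (val_inj kl) ltxx.
Qed.

Lemma slopes_inj a : injective (slopes S a).
Proof.
move=> k l kl; apply: val_inj => /=; case: (ltngtP k l) => //.
  by move/(slopes_incr S a); rewrite kl ltxx.
by move/(slopes_incr S a); rewrite kl ltxx.
Qed.

Lemma slopes_telescope e (k : 'I_r.+1) :
  slopes S (e, false) k =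
  slopes S (e, false) ord0 + \sum_(i < r | (i < k)%N) gap e i.
Proof.
pose s n := slopes S (e, false) (inord n).
have -> : \sum_(i < r | (i < k)%N) gap e i =
          \sum_(i < r | (i < k)%N) (s i.+1 - s i).
  apply: eq_bigr => i _; rewrite /gap /s; congr (slopes S _ _ - slopes S _ _).
    by apply: val_inj; rewrite /= inordK // ltnS.
  by apply: val_inj; rewrite /= inordK // ltnS ltnW.
have kr : (k <= r)%N by rewrite -ltnS.
rewrite (big_ord_narrow kr) /=.
rewrite -(big_mkord predT (fun n : nat => s n.+1 - s n)) telescope_sumr //.
rewrite /s inord_val addrC; set z := inord 0.
suff -> : z = ord0 by rewrite subrK.
by apply: val_inj; rewrite /= inordK.
Qed.

Lemma card_ord_lt n : (n <= r)%N -> #|[set j : 'I_r | (j < n)%N]%SET| = n.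
Proof.
move=> nr; rewrite -sum1_card; under eq_bigl do rewrite inE.
by rewrite (big_ord_narrow nr) sum1_card card_ord.
Qed.

(** A downward closed set of indices is an initial segment. *)
Lemma nested_count (P : pred 'I_r) i :
  (forall i j, (i <= j)%N -> P j -> P i) ->
  P i = (i < #|[set j | P j]%SET|)%N.
Proof.
move=> Pdown; apply/idP/idP => [Pi|].
  rewrite -[leqLHS](card_ord_lt (ltn_ord i)); apply: subset_leq_card.
  by apply/fintype.subsetP => j; rewrite !inE ltnS => /Pdown; exact.
apply: contraTT => nPi; rewrite -leqNgt -[leqRHS](card_ord_lt (ltnW (ltn_ord i))).
apply: subset_leq_card; apply/fintype.subsetP => j; rewrite !inE => Pj.
by rewrite ltnNge; apply: contra nPi => /Pdown; exact.
Qed.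

Lemma card_set_ord (A : {set 'I_r}) : (#|A| < r.+1)%N.
Proof. by rewrite ltnS -[leqRHS](card_ord r) max_card. Qed.

(** Between two consecutive breakpoints the slope index is the number of
    breakpoints ahead: as [T e] is nonincreasing, these are the first ones, and
    the gaps they contribute telescope. *)
Lemma profile_affine T e t t' u :
  nested T -> (forall i, T e i <= t \/ t' <= T e i) -> t <= u <= t' ->
  profile T e u = profile T e t +
    (slopes S (e, false) (inord #|[set i | t < T e i]%SET|))%:~R * (u - t).
Proof.
move=> [Tmono _] Tt /andP[tu ut']; set k := inord _.
have kE i : (t < T e i) = (i < k)%N.
  rewrite inordK ?card_set_ord //; apply: (@nested_count (fun i => t < T e i)).
  by move=> i' j /(Tmono e) Tji tT; exact: lt_le_trans tT Tji.
have sumE : \sum_i (gap e i)%:~R * Num.min u (T e i) =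
    \sum_i (gap e i)%:~R * Num.min t (T e i) +
    (\sum_(i < r | (i < k)%N) gap e i)%:~R * (u - t).
  rewrite raddf_sum /= mulr_suml [X in _ + X]big_mkcond /= -big_split /=.
  apply: eq_bigr => i _; rewrite -kE; case: ifP => [tT|/negbT].
    have uT : u <= T e i by case: (Tt i) => [|/(le_trans ut')//]; rewrite leNgt tT.
    by rewrite (min_idPl uT) (min_idPl (ltW tT)); ring.
  rewrite -leNgt => Tt'.
  by rewrite (min_idPr Tt') (min_idPr (le_trans Tt' tu)) addr0.
rewrite /profile sumE (slopes_telescope e k) rmorphD /=; ring.
Qed.

Lemma profile0 T e : nested T -> profile T e 0 = 0.
Proof.
move=> [_ T0]; rewrite /profile mulr0 add0r big1 // => i _.
by have /andP[/min_idPl -> _] := T0 e i; rewrite mulr0.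
Qed.

(** At the coordinate of x the slope index in direction nu counts the
    breakpoints strictly ahead of x. *)
Definition slope_index T (p : raw_point G) (a : oedge G) : 'I_r.+1 :=
  inord #|[set i | if a.2 then T a.1 i < edge_coord p a else edge_coord p a < T a.1 i]%SET|.

(** Backwards, the slope is read on the reversed edge, so the index counts the
    breakpoints that do not lie at or beyond the point. *)
Lemma slope_profiled f T (x : gpoint G) (nu : tangent x) :
  profiled f T -> slope f nu = slopes S (val nu) (slope_index T (val x) (val nu)).
Proof.
move=> [nT fE]; apply: slopeP.
have pE := edge_point_coord nu; have pr := coord_range nu.
have tE := travelE nu.
move: pE pr tE; rewrite /slope_index.
case: (val nu) => e [] /=; set p := edge_coord _ _ => pE /andP[p0 pl] tE.
- have near_T : \forall s \near (0 : R)^'+, forall i, T e i <= p - s \/ p <= T e i.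
    apply: filter_forall => i; case: (leP p (T e i)) => Tp; first by near=> s; right.
    near=> s; left; rewrite lerBrDr -lerBrDl; near: s.
    by apply: nbhs_right_le; rewrite subr_gt0.
  near=> s.
  have s0 : 0 < s by near: s; exact: nbhs_right_gt.
  have sp : s <= p by near: s; exact: nbhs_right_le.
  have Ts : forall i, T e i <= p - s \/ p <= T e i by near: s; exact: near_T.
  rewrite tE -pE (fE e p); last by lra.
  rewrite (fE e (p - s)); last by lra.
  rewrite (profile_affine nT Ts (_ : p - s <= p <= p)); last by lra.
  set k := inord _; set l := inord _.
  have -> : l = rev_ord k.
    apply: val_inj => /=; rewrite !inordK ?card_set_ord // subSS.
    rewrite [in RHS]cardsCs card_ord subKn -1?ltnS ?card_set_ord //; apply: eq_card => i.
    rewrite !inE; case: (Ts i) => h; apply/idP/idP; lra.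
  have := slopes_rev S (e, false) k; rewrite /rev_oedge /= => /eqP.
  rewrite addrC addr_eq0 => /eqP ->; rewrite rmorphN /=; ring.
- have near_T : \forall s \near (0 : R)^'+, forall i, T e i <= p \/ p + s <= T e i.
    apply: filter_forall => i; case: (leP (T e i) p) => Tp; first by near=> s; left.
    near=> s; right; rewrite -lerBrDl; near: s.
    by apply: nbhs_right_le; rewrite subr_gt0.
  near=> s.
  have s0 : 0 < s by near: s; exact: nbhs_right_gt.
  have sp : p + s <= len e.
    by rewrite -lerBrDl; near: s; apply: nbhs_right_le; rewrite subr_gt0.
  have Ts : forall i, T e i <= p \/ p + s <= T e i by near: s; exact: near_T.
  rewrite tE -pE (fE e p); last by lra.
  rewrite (fE e (p + s)); last by lra.
  rewrite (profile_affine nT Ts (_ : p <= p + s <= p + s)); last by lra.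
  by rewrite addrA; congr (_ + _ * _); ring.
Unshelve. all: by end_near. Qed.
End Profile.

(** * Ranks at interior points *)

Section InteriorPoints.
Variables (R : realType) (G : metric_graph R) (r : nat).
Variable S : slope_structure G r.

Lemma interior_tangent (x : gpoint G) e t b :
  val x = inr (e, t) -> exists nu : tangent x, val nu = (e, b).
Proof.
move=> xE; have h : (e, b) \in tangents (val x) by rewrite xE inE.
by exists (exist _ (e, b) h).
Qed.

Lemma slope_forward (f : gpoint G -> R) (x : gpoint G) (nu : tangent x) e q m :
  val nu = (e, false) -> edge_coord (val x) (val nu) < q ->
  (forall u, edge_coord (val x) (val nu) <= u <= q ->
    f (edge_point e u) = f x + m%:~R * (u - edge_coord (val x) (val nu))) ->
  slope f nu = m.
Proof.
move=> nuE; set p := edge_coord _ _ => pq fE; apply: slopeP; near=> s.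
have s0 : 0 < s by near: s; exact: nbhs_right_gt.
have sq : s <= q - p by near: s; apply: nbhs_right_le; rewrite subr_gt0.
rewrite travelE -/p nuE /= fE; last by lra.
by congr (_ + _ * _); ring.
Unshelve. all: by end_near. Qed.

Lemma slope_backward (f : gpoint G -> R) (x : gpoint G) (nu : tangent x) e q m :
  val nu = (e, true) -> q < edge_coord (val x) (val nu) ->
  (forall u, q <= u <= edge_coord (val x) (val nu) ->
    f x = f (edge_point e u) + m%:~R * (edge_coord (val x) (val nu) - u)) ->
  slope f nu = - m.
Proof.
move=> nuE; set p := edge_coord _ _ => qp fE; apply: slopeP; near=> s.
have s0 : 0 < s by near: s; exact: nbhs_right_gt.
have sq : s <= p - q by near: s; apply: nbhs_right_le; rewrite subr_gt0.
rewrite travelE -/p nuE /= (fE (p - s)); last by lra.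
by rewrite rmorphN /=; ring.
Unshelve. all: by end_near. Qed.

Lemma rank_atP (x : gpoint G) : rank_function (rank_at S x).
Proof.
case: x => -[u|[e t]] h; last exact: standard_rankP.
by rewrite gpoint_vertex; exact: vertex_rankP.
Qed.

(** Only the two orientations of [e] are tangent directions. *)
Lemma rank_at_interior (x : gpoint G) e t (nu nu' : tangent x)
    (a : cube (tangent x) r) :
  val x = inr (e, t) -> val nu = (e, false) -> val nu' = (e, true) ->
  rank_at S x a = Num.max (-1) (r%:Z - ((a nu)%:Z + (a nu')%:Z)).
Proof.
case: x nu nu' a => -[u|[e' t']] h //= nu nu' a [e'E _] nuE nu'E.
rewrite /rank_at /= /standard_rank; congr (Num.max _ (_ - _)).
rewrite (bigD1 nu) // (bigD1 nu') /=; last first.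
  by apply/eqP => nuu'; move: nuE; rewrite -nuu' nu'E.
rewrite big1 ?addr0 // => mu /andP[mu1 mu2]; exfalso.
have := valP mu; rewrite inE; case E : (val mu) => [e1 b] /= /eqP e1E.
have {e1E}E : val mu = (e, b) by rewrite E e1E e'E.
case: b E => E.
  by move/negP: mu2; apply; apply/eqP/val_inj; exact: etrans E (esym nu'E).
by move/negP: mu1; apply; apply/eqP/val_inj; exact: etrans E (esym nuE).
Qed.

Lemma slope_vector_inj (x : gpoint G) : injective (@slope_vector R G r S x).
Proof.
move=> a b /ffunP ab; apply/ffunP => nu; have := ab nu.
by rewrite !ffunE => /slopes_inj.
Qed.

Lemma rank_partialE (f : gpoint G -> R) (x : gpoint G) (a : cube (tangent x) r) :
  partial f x = slope_vector S a -> rank_partial S f x = rank_at S x a.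
Proof.
move=> fa; rewrite /rank_partial; congr (rank_at S x _).
by apply: xget_unique => //= b; rewrite fa => /slope_vector_inj ->.
Qed.

Lemma compatible_jump (f : gpoint G -> R) (x : gpoint G) : compatible S f ->
  exists a, jump (rank_at S x) a /\ partial f x = slope_vector S a.
Proof. by move=> /(_ x)[_ [a ja <-]]; exists a. Qed.

Lemma slope_of_partial (f : gpoint G -> R) (x : gpoint G) a (nu : tangent x) :
  partial f x = slope_vector S a -> slope f nu = slopes S (val nu) (a nu).
Proof. by move/ffunP/(_ nu); rewrite !ffunE. Qed.

Lemma slope_index_of_partial (f : gpoint G -> R) T (x : gpoint G) a (nu : tangent x) :
  profiled S f T -> partial f x = slope_vector S a ->
  a nu = slope_index T (val x) (val nu).
Proof.
move=> fT fa; apply: (@slopes_inj _ _ _ S (val nu)).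
by rewrite -(slope_of_partial nu fa) (slope_profiled nu fT).
Qed.

(** The slope indices in the two directions count the breakpoints ahead and the
    breakpoints behind; the standard rank counts the remaining ones. *)
Lemma rank_partial_interior (f : gpoint G -> R) T (x : gpoint G) e t :
  profiled S f T -> compatible S f -> val x = inr (e, t) ->
  rank_partial S f x = #|[set i | T e i == t]%SET|%:Z.
Proof.
move=> fT cf xE; have [a [_ fa]] := compatible_jump x cf.
have [nu nuE] := interior_tangent false xE.
have [nu' nu'E] := interior_tangent true xE.
rewrite (rank_partialE fa) (rank_at_interior _ xE nuE nu'E).
have aE : a nu = #|[set i | (t < T e i)%R]%SET| :> nat.
  rewrite (slope_index_of_partial _ fT fa) nuE xE.
  by rewrite /slope_index inordK ?card_set_ord.
have aE' : a nu' = #|[set i | (T e i < t)%R]%SET| :> nat.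
  rewrite (slope_index_of_partial _ fT fa) nu'E xE.
  by rewrite /slope_index inordK ?card_set_ord.
have : (#|[set i | (t < T e i)%R]%SET| + #|[set i | (T e i < t)%R]%SET| +
        #|[set i | T e i == t]%SET|)%N = r.
  have -> : [set i | T e i == t]%SET =
      (~: ([set i | t < T e i] :|: [set i | T e i < t]))%SET.
    by apply/setP => i; rewrite !inE; case: ltgtP.
  rewrite -cardsUI; set A := (_ :|: _)%SET.
  have -> : ([set i | (t < T e i)%R] :&: [set i | (T e i < t)%R])%SET = finset.set0.
    by apply/setP => i; rewrite !inE; case: ltgtP.
  by rewrite cards0 addn0 cardsC card_ord.
by rewrite -aE -aE'; lia.
Qed.

End InteriorPoints.

(** * Compatible functions are determined by their breakpoints *)

Section Profiles.
Variables (R : realType) (G : metric_graph R) (r : nat).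
Variable S : slope_structure G r.

(** At an interior breakpoint the indices in the two directions add up to at most
    [r], since the standard rank is nonnegative at a jump. So the slopes decrease
    along the edge, and [T i] is the point up to which the slope exceeds [s_i]. *)
Lemma profile_exists_edge (f : gpoint G -> R) (e : edges G) :
  RatG f -> compatible S f -> exists T : 'I_r -> R,
  [/\ forall i j : 'I_r, (i <= j)%N -> T j <= T i,
      forall i, 0 <= T i <= len e &
      forall t, 0 <= t <= len e ->
        f (edge_point e t) = f (edge_point e 0) + profile S (fun=> T) e t].
Proof.
move=> fR cf; have [n [tau [tau0 taun tau_lt tauS]]] := fR e.
have {tauS}[m mP] : exists m : nat -> int, forall j, (j < n)%N ->
    forall t, tau j <= t <= tau j.+1 ->
    f (edge_point e t) = f (edge_point e (tau j)) + (m j)%:~R * (t - tau j).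
  have : forall j, exists k : int, (j < n)%N -> forall t, tau j <= t <= tau j.+1 ->
    f (edge_point e t) = f (edge_point e (tau j)) + k%:~R * (t - tau j).
    move=> j; case: (ltnP j n) => [/tauS[k kP]|_]; first by exists k.
    by exists 0.
  by move=> /choice[m mP]; exists m.
have tau_mono i j : (i <= j <= n)%N -> tau i <= tau j.
  move=> /andP[ij jn]; elim: j ij jn => [|j IH]; first by rewrite leqn0 => /eqP ->.
  rewrite leq_eqVlt => /predU1P[->//|ij] jn.
  by apply: le_trans (IH ij (ltnW jn)) (ltW (tau_lt _ jn)).
have tau_ge0 j : (j <= n)%N -> 0 <= tau j.
  by move=> jn; rewrite -tau0; apply: tau_mono.
have tau_le j : (j <= n)%N -> tau j <= len e.
  by move=> jn; rewrite -taun; apply: tau_mono; rewrite jn leqnn.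
have m_slope j : (j < n)%N -> exists k, m j = slopes S (e, false) k.
  move=> jn; have lt := tau_lt _ jn; pose t := (tau j + tau j.+1) / 2.
  have := tau_ge0 _ (ltnW jn); have := tau_le _ jn => le1 ge0.
  have xE : val (edge_point e t) = inr (e, t).
    by apply: edge_point_interior; rewrite /t; lra.
  have [nu nuE] := interior_tangent false xE.
  have [/(_ nu)[k kE] _] := cf (edge_point e t); exists k.
  rewrite nuE in kE; rewrite -kE; apply/esym.
  apply: (@slope_forward _ _ _ _ nu e (tau j.+1)) => //; rewrite nuE xE /=.
    by rewrite /t; lra.
  move=> u ut; rewrite (mP _ jn u) ?(mP _ jn t); [ring|rewrite /t in ut *; lra..].
have m_noninc j : (j.+1 < n)%N -> m j.+1 <= m j.
  move=> jn; have jn' := ltnW jn; have lt := tau_lt _ jn; have lt' := tau_lt _ jn'.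
  have := tau_le _ jn; have := tau_ge0 _ (ltnW jn') => ge0 le1.
  set t := tau j.+1; have xE : val (edge_point e t) = inr (e, t).
    by apply: edge_point_interior; rewrite /t; lra.
  have [nu nuE] := interior_tangent false xE.
  have [nu' nu'E] := interior_tangent true xE.
  have [a [[ra _] fa]] := compatible_jump (edge_point e t) cf.
  have slopeR : slope f nu = m j.+1.
    apply: (@slope_forward _ _ _ _ nu e (tau j.+2)) => //; rewrite nuE xE //=.
    by move=> u ut; rewrite (mP _ jn u).
  have slopeL : slope f nu' = - m j.
    apply: (@slope_backward _ _ _ _ nu' e (tau j)) => //; rewrite nu'E xE //=.
    move=> u ut; rewrite (mP _ jn' u) // (mP _ jn' t); [ring|rewrite /t; lra].
  rewrite (slope_of_partial _ fa) nuE in slopeR.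
  rewrite (slope_of_partial _ fa) nu'E in slopeL.
  have := slopes_rev S (e, true) (a nu'); rewrite slopeL /rev_oedge /= => /eqP.
  rewrite addrC subr_eq0 => /eqP <-; rewrite -slopeR.
  rewrite (rank_at_interior _ _ xE nuE nu'E) in ra.
  have le_idx : (a nu <= rev_ord (a nu'))%N.
    by move: ra (ltn_ord (a nu')); rewrite le_max /=; lia.
  move: le_idx; rewrite leq_eqVlt => /predU1P[/val_inj -> //|lt_idx].
  exact/ltW/slopes_incr.
(* Induction over the affine pieces: a new piece of slope [m j] moves to its end
   the breakpoints of all slopes below [m j], which were at its start. Before
   the first piece, all breakpoints are at 0. *)
have profile_upto j : (j <= n)%N -> exists T : 'I_r -> R,
  [/\ forall i i' : 'I_r, (i <= i')%N -> T i' <= T i,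
      forall i, 0 <= T i <= tau j,
      forall i, j = 0%N \/ slopes S (e, false) (low i) < m j.-1 -> T i = tau j &
      forall t, 0 <= t <= tau j ->
        f (edge_point e t) = f (edge_point e 0) + profile S (fun=> T) e t].
  elim: j => [_|j IH jn].
    exists (fun=> 0); split=> //; first by move=> i; rewrite tau0 lexx.
    move=> t; rewrite tau0 => t0; have -> : t = 0 by lra.
    by rewrite profile0 ?addr0 //; split => // e' i; rewrite lexx ltW // len_gt0.
  have [T [Tmono Trange Ttop fE]] := IH (ltnW jn).
  have lt := tau_lt _ jn; have ge0 := tau_ge0 _ (ltnW jn).
  pose up i := slopes S (e, false) (low i) < m j.
  have upT i : up i -> T i = tau j.
    move=> ui; apply: Ttop; case: (posnP j) => [->|j0]; [by left|right].
    by have := m_noninc j.-1; rewrite prednK // => /(_ jn); exact: lt_le_trans.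
  exists (fun i => if up i then tau j.+1 else T i); split.
  - move=> i i' ii'; case: ifP => [ui'|_].
      suff -> : up i by [].
      move: ii'; rewrite leq_eqVlt => /predU1P[/val_inj -> //|].
      by move=> ii'; apply: lt_trans ui'; exact: slopes_incr.
    case: ifP => [_|_]; last exact: Tmono.
    by have := Trange i'; lra.
  - by move=> i; have := Trange i; case: ifP => _; lra.
  - by move=> i [//|/= ui]; rewrite /up ui.
  - move=> t /andP[t0 tj].
    have [k mk] := m_slope _ jn.
    have upk i : up i = (i < k)%N by rewrite /up mk slopes_mono.
    case: (leP t (tau j)) => ttau.
      rewrite fE ?t0 //; congr (_ + (_ + _)); apply: eq_bigr => i _; congr (_ * _).
      case: ifP => // /upT ->.
      by rewrite (min_idPl ttau) (min_idPl (le_trans ttau (ltW lt))).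
    rewrite (mP _ jn); last by lra.
    rewrite fE; last by lra.
    have sumE : \sum_i (gap S e i)%:~R * Num.min t (if up i then tau j.+1 else T i) =
        \sum_i (gap S e i)%:~R * Num.min (tau j) (T i) +
        (\sum_(i < r | (i < k)%N) gap S e i)%:~R * (t - tau j).
      rewrite raddf_sum /= mulr_suml [X in _ + X]big_mkcond /= -big_split /=.
      apply: eq_bigr => i _; rewrite -upk; case: ifP => [/upT ->|_].
        by rewrite (min_idPl tj) minxx; ring.
      have Ti : T i <= tau j by have := Trange i; lra.
      by rewrite (min_idPr Ti) (min_idPr (le_trans Ti (ltW ttau))) addr0.
    by rewrite /profile sumE mk (slopes_telescope S e k) rmorphD /=; ring.
have [T [Tmono Trange _ fE]] := profile_upto _ (leqnn n).
by rewrite taun in Trange fE; exists T; split.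
Qed.

Lemma profiled_exists (f : gpoint G -> R) :
  RatG f -> compatible S f -> exists T, profiled S f T.
Proof.
move=> fR cf; have /choice[T TP] := fun e => profile_exists_edge e fR cf.
exists T; split; first by split=> e; have [] := TP e.
by move=> e t te; have [_ _ ->] := TP e.
Qed.

Lemma sorted_lt_nth (s : seq R) i : sorted <%R s -> (i.+1 < size s)%N ->
  nth 0 s i < nth 0 s i.+1.
Proof. by move=> /(sortedP 0); exact. Qed.

(** The affine pieces end at the sorted breakpoints. *)
Lemma profiled_RatG (f : gpoint G -> R) T : profiled S f T -> RatG f.
Proof.
move=> [nT fE] e; have [Tmono Trange] := nT.
pose s := sort <=%R (undup (0 :: len e :: [seq T e i | i : 'I_r])).
have s_mem u : (u \in s) = (u \in 0 :: len e :: [seq T e i | i : 'I_r]).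
  by rewrite mem_sort mem_undup.
have s_lt : sorted <%R s by rewrite sort_lt_sorted undup_uniq.
have s_nth i j : (i <= j < size s)%N -> nth 0 s i <= nth 0 s j.
  move=> /andP[ij js]; apply: (sorted_leq_nth le_trans lexx) => //;
  by rewrite ?inE ?(leq_ltn_trans ij) //; exact: sort_le_sorted.
have s_range u : u \in s -> 0 <= u <= len e.
  rewrite s_mem !inE => /or3P[/eqP->|/eqP->|/mapP[i _ ->]] //.
    by rewrite lexx ltW ?len_gt0.
  by rewrite lexx ltW ?len_gt0.
have s_index u : u \in s -> exists2 j, (j < size s)%N & u = nth 0 s j.
  by move=> us; exists (index u s); rewrite ?index_mem ?nth_index.
have s0 : 0 \in s by rewrite s_mem inE eqxx.
have sl : len e \in s by rewrite s_mem !inE eqxx orbT.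
have sz : (0 < size s)%N by case: (s) s0.
have sn : (size s).-1.+1 = size s by rewrite prednK.
exists (size s).-1, (nth 0 s); split.
- have [j js j0] := s_index _ s0; apply: le_anti.
  have /s_range/andP[-> _] := mem_nth 0 sz.
  by rewrite andbT [leRHS]j0 s_nth.
- have [j js jl] := s_index _ sl; apply: le_anti.
  have /s_range/andP[_ ->] : nth 0 s (size s).-1 \in s by rewrite mem_nth ?sn.
  by rewrite [leLHS]jl s_nth // sn leqnn andbT -ltnS sn.
- by move=> i ir; apply: sorted_lt_nth => //; rewrite -ltn_predRL.
- move=> i ir; have ir' : (i.+1 < size s)%N by rewrite -ltn_predRL.
  have /s_range/andP[le0 _] := mem_nth 0 (ltnW ir').
  have /s_range/andP[_ le1] := mem_nth 0 ir'.
  have lt := sorted_lt_nth s_lt ir'.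
  have Ts k : T e k <= nth 0 s i \/ nth 0 s i.+1 <= T e k.
    have /s_index[j js ->] : T e k \in s.
      by rewrite s_mem !inE map_f ?orbT // mem_enum.
    by case: (leqP j i) => ij; [left|right]; apply: s_nth; rewrite ij // ltnW.
  exists (slopes S (e, false) (inord #|[set k | (nth 0 s i < T e k)%R]%SET|)) => t ti.
  rewrite fE; last by lra.
  rewrite (profile_affine S nT Ts ti) (fE e (nth 0 s i)) ?addrA //.
  by rewrite le0 (le_trans (ltW lt)).
Qed.

End Profiles.

(** * Limits of functions in an admissible semimodule *)

Section Ultrafilters.
Variables (T : Type) (U : set_system T).
Hypothesis ultraU : UltraFilter U.

Lemma ultra_cvg_segment (R : realType) (u : T -> R) (a b : R) :
  (forall n, a <= u n <= b) -> exists l, a <= l <= b /\ u @ U --> l.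
Proof.
move=> uab; have [|l [/= lab lU]] := @segment_compact R a b (u @ U) _.
  by apply: (@filterE _ U) => n /=; rewrite in_itv /= uab.
exists l; split; first by move: lab; rewrite in_itv.
move=> B lB; case: (in_ultra_setVsetC (u @^-1` B) ultraU) => // UB.
by have [y []] := lU (~` B) B UB lB.
Qed.

Lemma ultra_const (I : finType) (k : T -> I) : exists i, U [set n | k n = i].
Proof.
apply: contrapT => /forallNP nU.
have /filter_forall : forall i, \forall n \near U, k n <> i.
  move=> i; case: (in_ultra_setVsetC [set n | k n = i] ultraU) => [/nU|] //.
by case/filter_ex => n /(_ (k n)).
Qed.

End Ultrafilters.

Section Limit.
Variables (R : realType) (G : metric_graph R) (r : nat).
Variables (S : slope_structure G r).

Lemma profile_lipschitz (T T' : edges G -> 'I_r -> R) e (d t : R) :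
  (forall i, `|T e i - T' e i| <= d) ->
  `|profile S T e t - profile S T' e t| <= (\sum_i `|(gap S e i)%:~R|) * d.
Proof.
move=> Td; rewrite /profile opprD addrACA subrr add0r -sumrB mulr_suml.
apply: le_trans (ler_norm_sum _ _ _) _; apply: ler_sum => i _.
rewrite -mulrBr normrM ler_wpM2l // (le_trans _ (Td i)) //.
have := ler_norm (T e i - T' e i); have := ler_norm (T' e i - T e i).
rewrite (distrC (T' e i)) => h1 h2; rewrite ler_norml.
by rewrite /Num.min; do 2 case: ifP => ?; lra.
Qed.

Definition profile_extension (h : vertices G -> R) (T : edges G -> 'I_r -> R)
    (x : gpoint G) : R :=
  match val x with
  | inl u => h u
  | inr (e, t) => h (endpoint e false) + profile S T e t
  end.

Lemma profile_extensionP h T : nested T ->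
  (forall e, h (endpoint e true) = h (endpoint e false) + profile S T e (len e)) ->
  profiled S (profile_extension h T) T.
Proof.
move=> nT hE; split => // e t /andP[]; rewrite le_eqVlt => /predU1P[<- _|t0].
  by rewrite profile0 // addr0.
rewrite {2}/profile_extension edge_point0 /= le_eqVlt => /predU1P[->|te].
  by rewrite /profile_extension edge_point_len /= hE.
by rewrite /profile_extension edge_point_interior ?t0.
Qed.

Variables (D : divisor G) (M : set (gpoint G -> R)).
Hypothesis admM : admissible S D M.

(** Along an ultrafilter the breakpoints converge by compactness. So do the values
    at the vertices, after subtraction of the value at one vertex, by
    connectedness of the graph; the convergence of the functions is uniform. *)
Lemma semimodule_limit (U : set_system nat) (f : nat -> gpoint G -> R)
    (T : nat -> edges G -> 'I_r -> R) : UltraFilter U ->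
  (forall n, M (f n)) -> (forall n, profiled S (f n) (T n)) ->
  exists g T', [/\ M g, profiled S g T' &
    forall e i, (fun n => T n e i) @ U --> T' e i].
Proof.
move=> ultraU Mf fT; have [[_ _ Madd] Mclosed _ _] := admM.
have [T' T'P] : exists T' : edges G -> 'I_r -> R, forall e i,
    0 <= T' e i <= len e /\ (fun n => T n e i) @ U --> T' e i.
  have lim e i : exists l, 0 <= l <= len e /\ (fun n => T n e i) @ U --> l.
    by apply: ultra_cvg_segment => n; have [[_]] := fT n.
  have /choice[T' T'P] : forall e, exists l : 'I_r -> R, forall i,
      0 <= l i <= len e /\ (fun n => T n e i) @ U --> l i.
    by move=> e; have /choice[l lP] := lim e; exists l.
  by exists T'.
have nT' : nested T'.
  split; last by move=> e i; have [] := T'P e i.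
  move=> e i j ij; have [_ ci] := T'P e i; have [_ cj] := T'P e j.
  apply: ler_cvg_to cj ci _; apply: (@filterE _ U) => n.
  by have [[+ _] _] := fT n; exact.
have near_T e (d : R) : 0 < d ->
    \forall n \near U, forall i, `|T n e i - T' e i| <= d.
  move=> d0; apply: filter_forall => i; have [_ /cvgrPdist_le/(_ d d0)] := T'P e i.
  by apply: filterS => n; rewrite distrC.
have near_profile e (d : R) : 0 < d ->
    \forall n \near U, forall t, `|profile S (T n) e t - profile S T' e t| <= d.
  move=> d0; set c := \sum_i `|(gap S e i)%:~R| : R.
  have c0 : 0 <= c by apply: sumr_ge0.
  have /(near_T e) : 0 < d / (c + 1) by rewrite divr_gt0 // ltr_wpDl.
  apply: filterS => n /profile_lipschitz nT t; apply: le_trans (nT t) _.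
  rewrite -/c mulrA ler_pdivrMr ?ltr_wpDl // mulrC ler_wpM2l ?ltW //.
  by rewrite ltrDl.
have cvg_profile e t : (fun n => profile S (T n) e t) @ U --> profile S T' e t.
  apply/cvgrPdist_le => d /(near_profile e); apply: filterS => n.
  by rewrite distrC.
have f_end n e : f n (vertex (endpoint e true)) =
    f n (vertex (endpoint e false)) + profile S (T n) e (len e).
  have [_ fE] := fT n; rewrite -edge_point0 -edge_point_len fE //.
  by rewrite lexx ltW ?len_gt0.
have /card_gt0P[e0 _] := exists_edge G; pose w := endpoint e0 false.
pose g n x := f n x - f n (vertex w).
have [h hP] : exists h : vertices G -> R,
    forall u, (fun n => g n (vertex u)) @ U --> h u.
  suff /choice[h hP] : forall u, exists l : R, (fun n => g n (vertex u)) @ U --> l.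
    by exists h.
  move=> u.
  have /connectP[p pP ->] := graph_connected w u.
  have : exists l : R, (fun n => g n (vertex w)) @ U --> l.
    exists 0; apply: cvg_near_cst; apply: (@filterE _ U) => n.
    by rewrite /g subrr.
  elim: p (w) pP => [//|y p IH] x /= /andP[xy yp] [l xl]; apply: IH yp _.
  have /existsP[e /existsP[[] /andP[/eqP ex /eqP ey]]] := xy.
    exists (l - profile S T' e (len e)); rewrite (_ : (fun n => _) =
        (fun n => g n (vertex x) - profile S (T n) e (len e))).
      exact: cvgB.
    by apply/funext => n; rewrite /g -ex -ey /= f_end; ring.
  exists (l + profile S T' e (len e)); rewrite (_ : (fun n => _) =
      (fun n => g n (vertex x) + profile S (T n) e (len e))).
    exact: cvgD.
  by apply/funext => n; rewrite /g -ex -ey /= f_end; ring.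
have hE e : h (endpoint e true) = h (endpoint e false) + profile S T' e (len e).
  apply: (@cvg_unique _ (@Rhausdorff R) _ _ _ _ (hP (endpoint e true))).
  rewrite (_ : (fun n => _) =
      (fun n => g n (vertex (endpoint e false)) + profile S (T n) e (len e))).
    exact: cvgD.
  by apply/funext => n; rewrite /g f_end; ring.
have limT := profile_extensionP nT' hE.
exists (profile_extension h T'), T'; split => //; last first.
  by move=> e i; have [] := T'P e i.
apply: Mclosed; split; last exact: profiled_RatG limT.
move=> B /uniform_nbhs[E [entE EB]].
move: entE; rewrite -entourage_ballE => -[d /= d0 dE].
have d2 : 0 < d / 2 by lra. have d3 : 0 < d / 3 by lra.
have near_h : \forall n \near U, forall u, `|h u - g n (vertex u)| < d / 2.
  by apply: filter_forall => u; have /cvgrPdist_lt/(_ _ d2) := hP u.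
have near_p : \forall n \near U, forall e t,
    `|profile S (T n) e t - profile S T' e t| <= d / 3.
  by apply: filter_forall => e; exact: near_profile.
have [n [nh np]] := filter_ex (filterI near_h near_p).
exists (g n); split; first exact: Madd (Mf n).
apply: EB => -[[u|[e t]] xP] _; apply: dE => /=; rewrite /ball /=.
  rewrite gpoint_vertex /profile_extension /=.
  by apply: lt_le_trans (nh u) _; lra.
rewrite gpoint_interior /profile_extension edge_point_interior //=.
have := nh (endpoint e false); have := np e t.
rewrite /g; have [_ fE] := fT n; rewrite fE; last by move: xP => /= ?; lra.
rewrite -edge_point0 !ltr_norml !ler_norml; lra.
Unshelve. all: by [].
Qed.

End Limit.

(** * Divisors forcing a slope vector *)

Section Realization.
Variables (R : realType) (G : metric_graph R).

Lemma tangent_exists (x : gpoint G) : (0 < #|tangent x|)%N.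
Proof.
suff [nu _] : exists nu : tangent x, True by apply/card_gt0P; exists nu.
case: x => -[u|[e t]] h; last first.
  have h' : (e, true) \in tangents (inr (e, t) : raw_point G) by rewrite inE.
  by exists (exist _ (e, true) h').
suff [a ha] : exists a : oedge G, tail a = u.
  have h' : a \in tangents (inl u : raw_point G) by rewrite inE ha.
  by exists (exist _ a h').
have /card_gt0P[e0 _] := exists_edge G.
have /connectP[[_ /=|y p /=]] := graph_connected u (endpoint e0 false).
  by move=> <-; exists (e0, false).
by move=> /andP[/existsP[e /existsP[b /andP[/eqP eb _]]] _] _; exists (e, b).
Qed.

Lemma divisor_of_seq (s : seq (gpoint G)) : exists E : divisor G,
  (forall x, E x = (count_mem x s)%:Z) /\ degree E = (size s)%:Z.
Proof.
pose E : divisor G :=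
  [fsfun x in seq_fset tt s => (count_mem x s)%:Z].
have EE x : E x = (count_mem x s)%:Z.
  rewrite fsfunE seq_fsetE; case: ifP => // /negbT.
  by rewrite -has_pred1 has_count lt0n negbK => /eqP ->.
exists E; split => //; rewrite /degree.
have -> : \sum_(x <- finsupp E) E x = \sum_(x <- undup s) E x.
  apply: perm_big; apply: uniq_perm; rewrite ?undup_uniq ?fset_uniq // => x.
  rewrite mem_finsupp mem_undup EE -has_pred1 has_count lt0n.
  by case: count.
under eq_bigr do rewrite EE -[_%:Z]natz.
by rewrite big_undup_iterop_count big_const_seq count_predT iter_addr_0 natz.
Qed.

End Realization.

Section Forcing.
Variables (R : realType) (G : metric_graph R) (r : nat).
Variables (S : slope_structure G r) (D : divisor G) (M : set (gpoint G -> R)).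
Hypothesis admM : admissible S D M.

Lemma admissible_compatible f : M f -> compatible S f.
Proof. by case: admM => _ _ MD _ /MD[_]. Qed.

Lemma admissible_RatG f : M f -> RatG f.
Proof. by case: admM => -[MR _ _] _ _ _ /MR. Qed.

(** [s] stands for the effective divisor with the same multiplicities. *)
Definition meets (s : seq (gpoint G)) (f : gpoint G -> R) : Prop :=
  forall x, x \in s -> (count_mem x s)%:Z <= rank_partial S f x.

Definition forces (v : gpoint G) (s : seq (gpoint G)) (a : cube (tangent v) r) :=
  forall f, M f -> meets s f -> rank_at S v a <= rank_partial S f v ->
    partial f v = slope_vector S a.

Definition interior_away (v : gpoint G) (s : seq (gpoint G)) : Prop :=
  forall x, x \in s -> x <> v /\ exists e t, val x = inr (e, t).

(** The set of breakpoints lying at a given point is constant along the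
    ultrafilter, and the limits of these breakpoints stay at that point. *)
Lemma meets_limit (U : set_system nat) (s : seq (gpoint G)) v
    (f : nat -> gpoint G -> R) (T : nat -> edges G -> 'I_r -> R) g T' :
  UltraFilter U -> interior_away v s ->
  (forall n, M (f n)) -> (forall n, profiled S (f n) (T n)) ->
  M g -> profiled S g T' -> (forall e i, (fun n => T n e i) @ U --> T' e i) ->
  (forall n, meets s (f n)) -> meets s g.
Proof.
move=> ultraU sint Mf fT Mg gT cvT fs x xs.
have [_ [e [t xE]]] := sint _ xs.
rewrite (rank_partial_interior gT (admissible_compatible Mg) xE).
have [A UA] := ultra_const ultraU (fun n => [set i | T n e i == t]%SET).
have [n /= nA] := filter_ex UA.
apply: le_trans (fs n x xs) _.
rewrite (rank_partial_interior (fT n) (admissible_compatible (Mf n)) xE) nA.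
rewrite lez_nat; apply: subset_leq_card; apply/fintype.subsetP => i iA.
rewrite inE; apply/eqP; apply: (@cvg_unique _ (@Rhausdorff R) _ _ _ _ (cvT e i)).
apply: cvg_near_cst; apply: filterS UA => k /= kA.
by move: iA; rewrite -kA inE => /eqP.
Qed.

(** Strict inequalities are open: a breakpoint of the limit that is ahead of [v] is
    ahead of [v] for the nearby functions. *)
Lemma slope_index_limit (U : set_system nat) (T : nat -> edges G -> 'I_r -> R) T'
    (v : gpoint G) :
  UltraFilter U -> (forall e i, (fun n => T n e i) @ U --> T' e i) ->
  \forall n \near U, forall (nu : tangent v) i,
    (if (val nu).2 then T' (val nu).1 i < edge_coord (val v) (val nu)
     else edge_coord (val v) (val nu) < T' (val nu).1 i) ->
    (if (val nu).2 then T n (val nu).1 i < edge_coord (val v) (val nu)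
     else edge_coord (val v) (val nu) < T n (val nu).1 i).
Proof.
move=> ultraU cvT; apply: filter_forall => nu; apply: filter_forall => i.
have cvi := cvT (val nu).1 i; case: (val nu).2.
  case: ltP => [lt|_]; last exact: filterE.
  by apply: filterS (cvgr_lt _ cvi _ lt) => n.
case: ltP => [lt|_]; last exact: filterE.
by apply: filterS (cvgr_gt _ cvi _ lt) => n.
Qed.

(** If no point close to [v] on the branch [nu] works, the counterexamples have a
    limit with the vector [a'] at [v], while their own vectors are above [a'],
    strictly at [nu]. *)
Lemma forces_step (v : gpoint G) (s : seq (gpoint G)) (a a' : cube (tangent v) r) nu :
  interior_away v s -> forces s a' -> jump (rank_at S v) a ->
  rank_at S v a' = rank_at S v a + 1 ->
  (forall d, jump (rank_at S v) d -> cube_le a' d -> (a' nu < d nu)%N -> cube_le a d) ->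
  exists y, interior_away v (y :: s) /\ forces (y :: s) a.
Proof.
move=> s_off sa' ja ra' a'max; apply: contrapT => no_y.
set p := edge_coord (val v) (val nu); set e := (val nu).1; set b := (val nu).2.
have p_range : if b then 0 < p <= len e else 0 <= p < len e := coord_range nu.
(* Within distance [d] of [v], the branch consists of interior points. *)
pose d := if b then p / 2 else (len e - p) / 2.
have d0 : 0 < d by move: p_range; rewrite /d; case: (b); lra.
pose eps n : R := d * n.+1%:R^-1.
have eps0 n : 0 < eps n by rewrite mulr_gt0 ?invr_gt0.
have epsd n : eps n <= d by apply: ler_piMr; [exact: ltW|rewrite invf_le1 // ler1n].
pose c n := if b then p - eps n else p + eps n.
have c_range n : 0 < c n < len e.
  by have := eps0 n; have := epsd n; move: p_range; rewrite /c /d; case: (b); lra.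
have c_cvg : c @ \oo --> p.
  have eps_cvg : eps @ \oo --> (0 : R).
    by rewrite -[X in _ --> X](mulr0 d); apply: cvgMr; exact: cvg_harmonic.
  have cB : p - eps n @[n --> \oo] --> p - 0 by apply: cvgB eps_cvg; exact: cvg_cst.
  have cD : p + eps n @[n --> \oo] --> p + 0 by apply: cvgD eps_cvg; exact: cvg_cst.
  by rewrite subr0 in cB; rewrite addr0 in cD; rewrite /c; case: (b).
pose y n := edge_point e (c n).
have yE n : val (y n) = inr (e, c n) by rewrite edge_point_interior.
have y_off n : interior_away v (y n :: s).
  move=> x; rewrite inE => /predU1P[->|/s_off //]; split; last by exists e, (c n).
  move=> ynv; have := eps0 n; suff : c n = p by rewrite /c; case: (b); lra.
  have coordE q : q = inr (e, c n) -> edge_coord q (val nu) = c n by move=> ->.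
  by rewrite /p coordE // -ynv.
have /choice[f fP] : forall n, exists f, [/\ M f, meets (y n :: s) f,
    rank_at S v a <= rank_partial S f v & partial f v <> slope_vector S a].
  move=> n; apply: contrapT => nof; apply: no_y; exists (y n); split => //.
  by move=> f Mf fs fv; apply: contrapT => fa; apply: nof; exists f.
have Mf n : M (f n) by have [] := fP n.
have /choice[T fT] : forall n, exists T, profiled S (f n) T.
  by move=> n; exact: profiled_exists (admissible_RatG (Mf n)) (admissible_compatible (Mf n)).
have [U [ultraU ooU]] := ultraFilterLemma (@eventually_filter).
have [g [T' [Mg gT cvT]]] := semimodule_limit admM ultraU Mf fT.
have gs : meets s g.
  apply: (meets_limit ultraU s_off Mf fT Mg gT cvT) => n x xs.
  have [_ /(_ x) + _ _] := fP n; rewrite inE xs orbT => /(_ isT).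
  by apply: le_trans; rewrite lez_nat /= leq_addl.
(* A breakpoint of [f n] sits at [y n]; the same index for almost all [n]. *)
have /choice[k kP] : forall n, exists i, T n e i = c n.
  move=> n; have [_ /(_ (y n)) + _ _] := fP n; rewrite inE eqxx => /(_ isT).
  rewrite (rank_partial_interior (fT n) (admissible_compatible (Mf n)) (yE n)).
  rewrite /= eqxx add1n lez_nat => /(leq_trans (ltn0Sn _))/card_gt0P[i].
  by rewrite inE => /eqP; exists i.
have [i0 Ui0] := ultra_const ultraU k.
have T'i0 : T' e i0 = p.
  apply: (@cvg_unique _ (@Rhausdorff R) _ _ _ _ (cvT e i0)).
  have cU : c @ U --> p by apply: cvg_trans c_cvg => B; exact: ooU.
  apply: cvg_trans cU; apply: near_eq_cvg; apply: filterS Ui0 => n /= <-.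
  exact/esym.
have [n [/= ki0 Tn]] := filter_ex (filterI Ui0 (slope_index_limit v ultraU cvT)).
have [h [jh gh]] := compatible_jump v (admissible_compatible Mg).
have [l [jl fl]] := compatible_jump v (admissible_compatible (Mf n)).
have [_ _ ral nfa] := fP n; rewrite (rank_partialE fl) in ral.
have hl : cube_le h l.
  move=> nu'; rewrite (slope_index_of_partial _ gT gh).
  rewrite (slope_index_of_partial _ (fT n) fl) /slope_index !inordK ?card_set_ord //.
  by apply: subset_leq_card; apply/fintype.subsetP => i; rewrite !inE; exact: Tn.
have hl_nu : (h nu < l nu)%N.
  rewrite (slope_index_of_partial _ gT gh).
  rewrite (slope_index_of_partial _ (fT n) fl) /slope_index !inordK ?card_set_ord //.
  apply: proper_card; apply/properP; split.
    by apply/fintype.subsetP => i; rewrite !inE; exact: Tn.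
  exists i0; rewrite !inE -/p -/e -/b.
    by rewrite -ki0 kP /c; have := eps0 n; case: (b); lra.
  by rewrite T'i0 ltxx if_same.
have rhl : rank_at S v l < rank_at S v h.
  rewrite ltNge; apply/negP => /(jump_maximal (rank_atP S v) jh hl) hlE.
  by rewrite hlE ltnn in hl_nu.
have ha' : h = a'.
  apply: (@slope_vector_inj _ _ _ S v); rewrite -gh; apply: sa' => //.
  by rewrite (rank_partialE gh) ra'; move: ral rhl; lia.
have al : cube_le a l by apply: a'max; rewrite // -ha'.
by apply: nfa; rewrite fl (jump_maximal (rank_atP S v) ja al ral).
Qed.

(** Induction along the chain of jumps below [a], each step using one point. *)
Lemma forces_exists (v : gpoint G) (a : cube (tangent v) r) :
  jump (rank_at S v) a -> exists s,
    [/\ (size s)%:Z = r%:Z - rank_at S v a, interior_away v s & forces s a].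
Proof.
have /card_gt0P[nu0 _] := tangent_exists v; have rP := rank_atP S v.
have [n] := ubnP `|r%:Z - rank_at S v a|%N; elim: n a => // n IH a lt_n ja.
have [a0|a0] := pselect (a = [ffun=> ord0]).
  exists [::]; split => //; first by rewrite a0 (rank0 rP nu0) subrr.
  move=> f Mf _ fv; have [h [jh fh]] := compatible_jump v (admissible_compatible Mf).
  rewrite (rank_partialE fh) in fv; rewrite fh; congr slope_vector.
  by apply/esym/(jump_maximal rP ja _ fv) => i; rewrite a0 ffunE.
have [a' [nu [ja' ra' a'max]]] := jump_pred rP nu0 ja a0.
have ra'r : rank_at S v a' <= r%:Z by have [_ _ _ /(_ a')/andP[]] := rP.
have [|s [ss s_off sa']] := IH a' _ ja'; first by move: lt_n; lia.
have [y [y_off ya]] := forces_step s_off sa' ja ra' a'max.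
by exists (y :: s); split => //; rewrite /= -addn1 PoszD ss ra' opprD addrA subrK.
Qed.

End Forcing.

Theorem theorem1p2 (R : realType) (Gamma : metric_graph R) (r : nat)
    (D : divisor Gamma) (S : slope_structure Gamma r)
    (M : set (gpoint Gamma -> R)) :
  admissible S D M ->
  forall (v : gpoint Gamma) (a : cube (tangent v) r),
    jump (rank_at S v) a ->
    exists f : gpoint Gamma -> R, M f /\ partial f v = slope_vector S a.
Proof.
move=> admM v a ja; have [s [ss s_off sa]] := forces_exists admM ja.
have ra0 : 0 <= rank_at S v a by case: ja.
pose m := `|rank_at S v a|%N.
have [E [EE degE]] := divisor_of_seq (nseq m v ++ s).
have [_ _ _ /(_ E)[||f [Mf fE _]]] := admM.
- by move=> x; rewrite EE.
- by rewrite degE size_cat size_nseq /m; lia.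
exists f; split => //; apply: sa => //.
  move=> x xs; apply: le_trans (fE x).
  by rewrite EE lez_nat count_cat leq_addl.
apply: le_trans (fE v); rewrite EE count_cat count_nseq /= eqxx mul1n /m.
lia.
Qed.
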